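(* Let $K \subset \mathbb{R}^m$ be a full-dimensional closed convex cone and let $P\subset\mathbb{R}^n$ be a full-dimensional polytope with the origin in its interior. If $P$ has a proper $K$-lift, then every slack matrix of $P$ admits a $K$-factorization. Conversely, if some slack matrix of $P$ has a $K$-factorization, then $P$ has a $K$-lift.
   Context: A $K$-lift of $P$ is a set $K\cap L$, with $L\subset\mathbb{R}^m$ an affine subspace, together with a linear map $\pi : \mathbb{R}^m\to\mathbb{R}^n$ such that $P = \pi(K\cap L)$; it is proper if $L$ intersects the interior of $K$. Let $p_1,\dots,p_v$ be the vertices of $P$ and $F_1,\dots,F_f$ its facets. Each facet $F_j$ corresponds to a linear (affine) inequality $h_j(x)\ge 0$, unique up to positive scaling, valid on $P$ and with $F_j = \{x\in P : h_j(x)=0\}$; these give the irredundant representation $P = \{x\in\mathbb{R}^n : h_1(x)\ge 0,\dots,h_f(x)\ge0\}$. For any such representation, the nonnegative matrix in $\mathbb{R}^{v\times f}$ whose $(i,j)$-entry is $h_j(p_i)$ is called a slack matrix of $P$. A $K$-factorization of a nonnegative matrix $M\in\mathbb{R}_+^{p\times q}$ is a pair of ordered sets $a^1,\dots,a^p\in K$ and $b^1,\dots,b^q\in K^*$ with $\langle a^i,b^j\rangle = M_{ij}$ for all $i,j$, where $K^* = \{y : \langle x,y\rangle\ge0\ \forall x\in K\}$. *)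

(* Defs.v *)
From mathcomp Require Import all_boot all_order all_algebra.
From mathcomp Require Import all_classical all_reals all_analysis.

Set Implicit Arguments.
Unset Strict Implicit.
Unset Printing Implicit Defensive.

Import Order.TTheory GRing.Theory Num.Theory.
Import numFieldNormedType.Exports.

Local Open Scope classical_set_scope.
Local Open Scope ring_scope.

Definition dotp (R : realType) (n : nat) (x y : 'rV[R]_n) : R :=
  \sum_(i < n) x ord0 i * y ord0 i.

Definition is_affine_subspace (R : realType) (n : nat) (L : set 'rV[R]_n) :
    Prop :=
  exists (x0 : 'rV[R]_n) (V : {vspace 'rV[R]_n}),
    L = [set x | x - x0 \in V].

Definition affine_hull (R : realType) (n : nat) (S : set 'rV[R]_n) :
    set 'rV[R]_n :=
  [set x | exists (k : nat) (s : 'I_k -> 'rV[R]_n) (w : 'I_k -> R),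
     [/\ forall i, S (s i), \sum_(i < k) w i = 1
       & x = \sum_(i < k) w i *: s i]].

(* The dimension of S is that of its affine hull; the empty set has no
   dimension d : nat, in accordance with the convention dim set0 = -1. *)
Definition has_dim (R : realType) (n : nat) (S : set 'rV[R]_n) (d : nat) :
    Prop :=
  exists (x0 : 'rV[R]_n) (V : {vspace 'rV[R]_n}),
    \dim V = d /\ affine_hull S = [set x | x - x0 \in V].

Definition full_dimensional (R : realType) (n : nat) (S : set 'rV[R]_n) :
    Prop :=
  has_dim S n.

Definition is_affine_fun (R : realType) (n : nat) (h : 'rV[R]_n -> R) : Prop :=
  exists (u : 'rV[R]_n) (c : R), forall x, h x = dotp u x + c.

Definition is_convex_cone (R : realType) (m : nat) (K : set 'rV[R]_m) : Prop :=
  [/\ K !=set0, convex_set K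
    & forall (a : R) (x : 'rV[R]_m), 0 <= a -> K x -> K (a *: x)].

Definition dual_cone (R : realType) (m : nat) (K : set 'rV[R]_m) :
    set 'rV[R]_m :=
  [set y | forall x, K x -> 0 <= dotp x y].

Definition is_polytope (R : realType) (n : nat) (P : set 'rV[R]_n) : Prop :=
  exists (k : nat) (s : 'I_k -> 'rV[R]_n),
    P = [set x | exists w : 'I_k -> R,
           [/\ forall i, 0 <= w i, \sum_(i < k) w i = 1
             & x = \sum_(i < k) w i *: s i]].

Definition is_face (R : realType) (n : nat) (P F : set 'rV[R]_n) : Prop :=
  exists h : 'rV[R]_n -> R,
    [/\ is_affine_fun h, forall x, P x -> 0 <= h x
      & F = P `&` [set x | h x = 0]].

Definition is_vertex (R : realType) (n : nat) (P : set 'rV[R]_n)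
    (p : 'rV[R]_n) : Prop :=
  is_face P [set p].

Definition is_facet (R : realType) (n : nat) (P F : set 'rV[R]_n) : Prop :=
  is_face P F /\ exists d : nat, has_dim P d.+1 /\ has_dim F d.

Definition is_lift (R : realType) (m n : nat) (K : set 'rV[R]_m)
    (P : set 'rV[R]_n) (L : set 'rV[R]_m)
    (phi : {linear 'rV[R]_m -> 'rV[R]_n}) : Prop :=
  is_affine_subspace L /\ P = phi @` (K `&` L).

Definition has_lift (R : realType) (m n : nat) (K : set 'rV[R]_m)
    (P : set 'rV[R]_n) : Prop :=
  exists (L : set 'rV[R]_m) (phi : {linear 'rV[R]_m -> 'rV[R]_n}),
    is_lift K P L phi.

Definition has_proper_lift (R : realType) (m n : nat) (K : set 'rV[R]_m)
    (P : set 'rV[R]_n) : Prop :=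
  exists (L : set 'rV[R]_m) (phi : {linear 'rV[R]_m -> 'rV[R]_n}),
    is_lift K P L phi /\ L `&` interior K !=set0.

(* The vertices p and the facets F are each listed exactly once, in an
   arbitrary order; each h j is any affine function defining F j. *)
Definition is_slack_matrix (R : realType) (n : nat) (P : set 'rV[R]_n)
    (v f : nat) (M : 'M[R]_(v, f)) : Prop :=
  exists (p : 'I_v -> 'rV[R]_n) (F : 'I_f -> set 'rV[R]_n)
         (h : 'I_f -> 'rV[R]_n -> R),
    [/\ injective p /\ range p = [set x | is_vertex P x],
        injective F /\ range F = [set G | is_facet P G],
        forall j, is_affine_fun (h j),
        forall j, (forall x, P x -> 0 <= h j x) /\
                  F j = [set x | P x /\ h j x = 0]
      & M = \matrix_(i < v, j < f) h j (p i)].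

Definition has_factorization (R : realType) (m : nat) (K : set 'rV[R]_m)
    (p q : nat) (M : 'M[R]_(p, q)) : Prop :=
  exists (a : 'I_p -> 'rV[R]_m) (b : 'I_q -> 'rV[R]_m),
    [/\ forall i, K (a i), forall j, dual_cone K (b j)
      & forall i j, dotp (a i) (b j) = M i j].

(* Main.v *)
(* For a proper lift, an inequality h >= 0 on P pulls back to an affine function
   on the slice L that is nonnegative on K `&` L; its homogenisation on the span
   of L extends to a functional nonnegative on K because L meets the interior of
   K, and this functional pairs with preimages of the vertices to give h's column
   of the slack matrix.  Conversely, given a factorization (a, b), let
   L = {z | exists x, forall j, h_j x = <z, b_j>}.  A point z of K `&` L forces
   h_j x >= 0, so x lies in P, and x depends affinely on z; this dependence is
   linear after extension because 0 is not in L.  Every vertex p_i is hit by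
   a_i. *)
Require Import Defs.
From mathcomp Require Import all_boot all_order all_algebra.
From mathcomp Require Import all_classical all_reals all_analysis.
From mathcomp Require Import lra.

Import Order.TTheory GRing.Theory Num.Theory.
Import numFieldNormedType.Exports.

Local Open Scope classical_set_scope.
Local Open Scope ring_scope.

(** * Inner product algebra *)

Section Dot.
Context {R : realType} {n : nat}.
Implicit Types x y z u v : 'rV[R]_n.

Lemma dotpC x y : dotp x y = dotp y x.
Proof. by apply: eq_bigr => i _; rewrite mulrC. Qed.

Lemma dotpDl x y z : dotp (x + y) z = dotp x z + dotp y z.
Proof.
by rewrite /dotp -big_split; apply: eq_bigr => i _; rewrite mxE mulrDl.
Qed.

Lemma dotpZl a x y : dotp (a *: x) y = a * dotp x y.
Proof.
by rewrite /dotp mulr_sumr; apply: eq_bigr => i _; rewrite mxE mulrA.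
Qed.

Lemma dotpDr x y z : dotp x (y + z) = dotp x y + dotp x z.
Proof. by rewrite dotpC dotpDl !(dotpC _ x). Qed.

Lemma dotpZr a x y : dotp x (a *: y) = a * dotp x y.
Proof. by rewrite dotpC dotpZl dotpC. Qed.

Lemma dotp0l x : dotp 0 x = 0.
Proof. by rewrite -[0](scale0r x) dotpZl mul0r. Qed.

Lemma dotp0r x : dotp x 0 = 0.
Proof. by rewrite dotpC dotp0l. Qed.

Lemma dotpNl x y : dotp (- x) y = - dotp x y.
Proof. by rewrite -scaleN1r dotpZl mulN1r. Qed.

Lemma dotpNr x y : dotp x (- y) = - dotp x y.
Proof. by rewrite dotpC dotpNl dotpC. Qed.

Lemma dotpBl x y z : dotp (x - y) z = dotp x z - dotp y z.
Proof. by rewrite dotpDl dotpNl. Qed.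

Lemma dotpBr x y z : dotp x (y - z) = dotp x y - dotp x z.
Proof. by rewrite dotpDr dotpNr. Qed.

Lemma dotp_sumr (I : finType) (P : pred I) (F : I -> 'rV[R]_n) x :
  dotp x (\sum_(i | P i) F i) = \sum_(i | P i) dotp x (F i).
Proof.
by apply: (big_morph (dotp x)) => [y z|]; rewrite ?dotpDr ?dotp0r.
Qed.

Lemma dotp_ge0 x : 0 <= dotp x x.
Proof. by apply: sumr_ge0 => i _; rewrite -expr2 sqr_ge0. Qed.

Lemma dotp_eq0 x : (dotp x x == 0) = (x == 0).
Proof.
apply/eqP/eqP => [xx|->]; last exact: dotp0l.
apply/rowP => i; rewrite mxE; apply/eqP; rewrite -sqrf_eq0 expr2; apply/eqP.
by move: xx => /psumr_eq0P-> // j _; rewrite -expr2 sqr_ge0.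
Qed.

Lemma dotp_gt0 x : x != 0 -> 0 < dotp x x.
Proof. by move=> x0; rewrite lt_def dotp_eq0 x0 dotp_ge0. Qed.

Lemma dotp_comb_const (I : finType) (w : I -> R) (s : I -> 'rV[R]_n) u c :
  \sum_i w i = 1 ->
  dotp u (\sum_i w i *: s i) + c = \sum_i w i * (dotp u (s i) + c).
Proof.
move=> w1; rewrite dotp_sumr -[c in LHS]mul1r -w1 mulr_suml -big_split /=.
by apply: eq_bigr => i _; rewrite dotpZr mulrDr.
Qed.

End Dot.

(** This is the transpose of [phi] applied to [c]; its coordinates are read off on the standard
    basis. *)
Lemma dotp_adjoint {R : realType} {m n : nat}
    (phi : {linear 'rV[R]_m -> 'rV[R]_n}) (c : 'rV[R]_n) :
  exists u, forall x, dotp u x = dotp c (phi x).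
Proof.
exists (\row_i dotp c (phi (delta_mx ord0 i))) => x.
rewrite [x in RHS]row_sum_delta linear_sum dotp_sumr; apply: eq_bigr => i _.
by rewrite linearZ dotpZr mxE mulrC.
Qed.

(** * Separating functionals and interior points *)

Section Separation.
Context {R : realType} {n : nat}.

(** The map [q], identity minus a projection onto [W], kills [W] but not [v]; the normalised
    functional of [q v] is pulled back along [q]. *)
Lemma dual_vector (W : {vspace 'rV[R]_n}) (v : 'rV[R]_n) : v \notin W ->
  exists u, dotp u v = 1 /\ forall w, w \in W -> dotp u w = 0.
Proof.
move=> vW; pose q := (\1 - projv W)%VF.
have qE w : q w = w - projv W w by rewrite add_lfunE opp_lfunE id_lfunE.
have q0 w : w \in W -> q w = 0 by move=> wW; rewrite qE projv_id // subrr.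
have qv0 : q v != 0.
  rewrite qE subr_eq0; apply: contraNneq vW => ->; exact: memv_proj.
have [u hu] := dotp_adjoint q ((dotp (q v) (q v))^-1 *: q v).
exists u; split=> [|w wW]; rewrite hu dotpZl /=.
  by rewrite mulVf // dotp_eq0.
by rewrite (q0 w) // dotp0r mulr0.
Qed.

Lemma interior_direction (S : set 'rV[R]_n) e v :
  interior S e -> exists2 t : R, 0 < t & S (e + t *: v).
Proof.
rewrite /interior => Se.
have c : (fun t : R => e + t *: v) t @[t --> (0:R)^'+] --> e.
  rewrite -[X in _ --> X]addr0 -[X in _ + X](scale0r v).
  apply: cvg_at_right_filter.
  by apply: cvgD; [exact: cvg_cst| apply: cvgZr_tmp; exact: cvg_id].
have : \forall t \near (0:R)^'+, 0 < t /\ S (e + t *: v).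
  by near=> t; split; near: t; [exact: nbhs_right_gt | exact: c Se].
by move=> /filter_ex[t [t0 St]]; exists t.
Unshelve. all: by end_near. Qed.

End Separation.

(** * Convex cones and extension of nonnegative functionals *)

Section Cone.
Context {R : realType} {m : nat} {K : set 'rV[R]_m}.
Hypothesis Kcone : is_convex_cone K.

Lemma coneZ a x : 0 <= a -> K x -> K (a *: x).
Proof. by case: Kcone => _ _; apply. Qed.

Lemma coneD x y : K x -> K y -> K (x + y).
Proof.
move=> Kx Ky; case: Kcone => _ cK _.
have [h0 h1] : 0 <= 2^-1 :> R /\ 2^-1 <= 1 :> R by split; lra.
have Kxy : K (2^-1 *: x + (1 - 2^-1) *: y) :=
  set_mem (cK x y (Itv01 h0 h1) (mem_set Kx) (mem_set Ky)).
have := coneZ 2 _ (ler0n _ _) Kxy; rewrite scalerDr !scalerA.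
have -> : 2 * (1 - 2^-1) = 1 :> R by lra.
by rewrite divff ?pnatr_eq0 // !scale1r.
Qed.

(* M. Riesz extension: adding one dimension at a time, the values allowed at
   the new vector form an interval, which is nonempty because e is an order
   unit for K. *)
Lemma dual_cone_extension (W : {vspace 'rV[R]_m}) e u :
  interior K e -> e \in W ->
  (forall x, K x -> x \in W -> 0 <= dotp u x) ->
  exists2 b, dual_cone K b & forall x, x \in W -> dotp x b = dotp u x.
Proof.
move=> Ke; elim/ltn_ind: {W}(m - \dim W)%N {-2}W (erefl (m - \dim W)%N) u.
move=> d IH W Wd u eW u0.
have [Wf|/subvPn[v _ vW]] := boolP (fullv <= W)%VS.
  exists u => x; last by rewrite dotpC.
  by move=> Kx; rewrite dotpC; apply: u0; rewrite // (subvP Wf) ?memvf.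
(* [S] collects the lower bounds that [K] imposes on the value at [v]; points [w - v] of [K] give
   the upper bounds. The value chosen is [sup S]. *)
pose S := [set r | exists2 w, w \in W /\ K (w + v) & r = - dotp u w].
have ubS w : w \in W -> K (w - v) -> ubound S (dotp u w).
  move=> wW Kw _ [w' [w'W Kw'] ->]; rewrite -subr_ge0 opprK -dotpDr.
  apply: u0; rewrite ?memvD //.
  by move: (coneD _ _ Kw Kw'); rewrite addrACA addNr addr0.
have dirK (s : 'rV_m) : exists2 w, w \in W & K (w + s).
  have [t t0 Kt] := interior_direction _ _ s Ke.
  exists (t^-1 *: e); first exact: memvZ.
  have := coneZ t^-1 _ _ Kt; rewrite invr_ge0 (ltW t0) => /(_ isT).
  by rewrite scalerDr scalerA mulVf ?gt_eqF // scale1r.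
have [w1 w1W Kw1] := dirK v; have [w2 w2W Kw2] := dirK (- v).
have S0 : S !=set0 by exists (- dotp u w1), w1.
have Sb : has_ubound S by exists (dotp u w2); exact: ubS.
have [eta [etav etaW]] := dual_vector W v vW.
pose u' := u + (sup S - dotp u v) *: eta.
have u'E w t : w \in W -> dotp u' (w + t *: v) = dotp u w + t * sup S.
  move=> wW; rewrite dotpDl dotpZl !dotpDr !dotpZr etav etaW //; lra.
have [|||b Kb bE] := IH (m - \dim (W + <[v]>)%VS)%N _ (W + <[v]>)%VS erefl u'.
- have : (\dim W < \dim (W + <[v]>)%VS)%N.
    rewrite ltn_neqAle dimvS ?addvSl // andbT.
    apply: contra vW => /eqP dE.
    have /eqP-> : W == (W + <[v]>)%VS by rewrite eqEdim addvSl dE leqnn.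
    by rewrite memvE addvSr.
  have := dimvS (subvf (W + <[v]>)%VS); rewrite dimvf /dim /= mul1n -Wd.
  by move=> h1 h2; rewrite ltn_sub2l // (leq_trans h2 h1).
- by rewrite -[e]addr0 memv_add ?mem0v.
(* Rescaling by the inverse of [|t|] turns [x] into a witness of a lower bound if [t > 0], of an
   upper bound if [t < 0]. *)
- move=> x Kx /memv_addP[w wW [_ /vlineP[t ->] xE]].
  rewrite xE u'E //; rewrite {}xE in Kx.
  have [t0|t0|t0] := ltrgt0P t; last by
      rewrite t0 mul0r addr0 u0 //; move: Kx; rewrite t0 scale0r addr0.
  + have : - dotp u (t^-1 *: w) <= sup S.
      apply: ub_le_sup => //; exists (t^-1 *: w) => //; split; first exact: memvZ.
      have := coneZ t^-1 _ _ Kx; rewrite scalerDr scalerA mulVf ?gt_eqF //.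
      by rewrite scale1r; apply; rewrite invr_ge0 ltW.
    by rewrite dotpZr -mulrN ler_pdivrMl // => h; lra.
  + have : sup S <= dotp u ((- t)^-1 *: w).
      apply: ge_sup => //; apply: ubS; first exact: memvZ.
      have := coneZ (- t)^-1 _ _ Kx; rewrite scalerDr scalerA invrN mulNr.
      rewrite mulVf ?lt_eqF // scaleN1r; apply.
      by rewrite -invrN invr_ge0 oppr_ge0 ltW.
    by rewrite dotpZr ler_pdivlMl ?oppr_gt0 // => h; lra.
- exists b => // x xW; rewrite bE; last by rewrite -[x]addr0 memv_add ?mem0v.
  by rewrite -[x]addr0 -(scale0r v) u'E // mul0r addr0 scale0r addr0.
Qed.

End Cone.

(* When a hyperplane y separates b from all generators but the first one, a0,
   one projects along a0 onto the orthogonal of y. *)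
Lemma farkas {R : realType} {n k : nat} (a : 'I_k -> 'rV[R]_n) b :
  (exists2 w : 'I_k -> R, forall i, 0 <= w i & b = \sum_i w i *: a i) \/
  (exists2 y, forall i, 0 <= dotp y (a i) & dotp y b < 0).
Proof.
elim: k a b => [|k IH] a b.
  have [->|b0] := eqVneq b 0.
    by left; exists (fun=> 0) => //; rewrite big_ord0.
  by right; exists (- b) => [[]//|]; rewrite dotpNl oppr_lt0 dotp_gt0.
pose cons c (w : 'I_k -> R) i := if unlift ord0 i is Some j then w j else c.
have cons_ge0 c w : 0 <= c -> (forall i, 0 <= w i) -> forall i, 0 <= cons c w i.
  by move=> c0 w0 i; rewrite /cons; case: unliftP.
have cons_sum c w :
    \sum_i cons c w i *: a i = c *: a ord0 + \sum_i w i *: a (lift ord0 i).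
  rewrite big_ord_recl /cons unlift_none; congr (_ + _).
  by apply: eq_bigr => i _; rewrite liftK.
have [[w w0 ->]|[y y0 yb]] := IH (a \o lift ord0) b.
  by left; exists (cons 0 w); rewrite ?cons_sum ?scale0r ?add0r //; exact: cons_ge0.
have [ya0|ya0] := leP 0 (dotp y (a ord0)).
  right; exists y => // i; case: (unliftP ord0 i) => [j ->|-> //]; exact: y0.
(* The coefficient for which [x + r x *: a ord0] is orthogonal to [y]. *)
pose r x := dotp y x / - dotp y (a ord0).
have [[w w0 bE]|[z z0 zb]] :=
    IH (fun i => a (lift ord0 i) + r (a (lift ord0 i)) *: a ord0)
       (b + r b *: a ord0).
(* The weight of [a ord0] is nonnegative: [r] is nonnegative on the other generators and negative at
   [b]. *)
- left; exists (cons (\sum_i w i * r (a (lift ord0 i)) - r b) w).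
    apply: cons_ge0 => //; rewrite subr_ge0; apply: (@le_trans _ _ 0).
      by rewrite /r pmulr_lle0 ?invr_gt0 ?oppr_gt0 // ltW.
    apply: sumr_ge0 => i _; apply: mulr_ge0 => //.
    by apply: divr_ge0; [exact: y0 | rewrite oppr_ge0 ltW].
  rewrite cons_sum -[LHS](addrK (r b *: a ord0)) bE scalerBl.
  rewrite [RHS]addrAC; congr (_ - _).
  rewrite scaler_suml -big_split /=; apply: eq_bigr => i _.
  by rewrite scalerDr scalerA addrC.
(* [y'] is [z] composed with the projection along [a ord0], so it vanishes at [a ord0]. *)
- right; pose y' := z + (dotp z (a ord0) / - dotp y (a ord0)) *: y.
  have y'E x : dotp y' x = dotp z (x + r x *: a ord0).
    rewrite dotpDl dotpDr dotpZl dotpZr /r; congr (_ + _).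
    by rewrite -mulrA mulrC [_^-1 * _]mulrC.
  exists y' => [i|]; rewrite y'E //.
  case: (unliftP ord0 i) => [j ->|->]; first exact: z0.
  by rewrite /r invrN mulrN divff ?lt_eqF // scaleN1r subrr dotp0r.
Qed.

(** * Polytopes: separation, vertices, boundedness *)

Section Polytope.
Context {R : realType} {n : nat}.

Definition conv_on {k} (A : {set 'I_k}) (s : 'I_k -> 'rV[R]_n) : set 'rV[R]_n :=
  [set x | exists w : 'I_k -> R,
     [/\ forall i, 0 <= w i, forall i, i \notin A -> w i = 0,
         \sum_i w i = 1 & x = \sum_i w i *: s i]].

(** Farkas' lemma for the points homogenised by a leading coordinate 1, which encodes the total
    weight; generators outside [A] become 0. *)
Lemma conv_on_separation {k} (A : {set 'I_k}) s x :
  conv_on A s x \/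
  exists y c, (forall i, i \in A -> 0 <= dotp y (s i) + c) /\ dotp y x + c < 0.
Proof.
pose lift1 (z : 'rV[R]_n) : 'rV_(1 + n) := row_mx (const_mx 1) z.
pose hd (z : 'rV[R]_(1 + n)) := z ord0 (lshift n ord0).
have dotp_lift1 y z : dotp y (lift1 z) = dotp (rsubmx y) z + hd y.
  rewrite /dotp big_split_ord big_ord1 /= row_mxEl mxE mulr1 addrC.
  by congr (_ + _); apply: eq_bigr => i _; rewrite row_mxEr mxE.
have [[w w0 xE]|[y y0 yx]] :=
    farkas (fun i => if i \in A then lift1 (s i) else 0) (lift1 x); last first.
  right; exists (rsubmx y), (hd y); rewrite -dotp_lift1; split=> // i iA.
  by rewrite -dotp_lift1; move: (y0 i); rewrite iA.
left; exists (fun i => if i \in A then w i else 0); split.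
- by move=> i; case: ifP.
- by move=> i /negbTE->.
- move/(congr1 hd): xE; rewrite /hd row_mxEl mxE summxE => ->.
  apply: eq_bigr => i _; case: ifP => _; rewrite mxE ?row_mxEl ?mxE ?mulr1 //.
  by rewrite mulr0.
- move/(congr1 (@rsubmx _ _ _ _)): xE; rewrite row_mxKr linear_sum /= => ->.
  apply: eq_bigr => i _; rewrite linearZ /=; case: ifP => _.
    by rewrite row_mxKr.
  by rewrite linear0 scaler0 scale0r.
Qed.

Lemma conv_onT {k} (s : 'I_k -> 'rV[R]_n) :
  [set x | exists w : 'I_k -> R,
     [/\ forall i, 0 <= w i, \sum_(i < k) w i = 1
       & x = \sum_(i < k) w i *: s i]] = conv_on [set: 'I_k]%SET s.
Proof.
apply/seteqP; split=> x [w].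
  by case=> w0 w1 xE; exists w; split=> // i; rewrite inE.
by case=> w0 _ w1 xE; exists w.
Qed.

Lemma conv_on_gen {k} (A : {set 'I_k}) (s : 'I_k -> 'rV[R]_n) i :
  i \in A -> conv_on A s (s i).
Proof.
move=> iA; exists (fun j => (j == i)%:R); split=> [j|j jA||].
- exact: ler0n.
- by rewrite (negbTE (contraNneq _ jA)) // => ->.
- by rewrite (bigD1 i) //= eqxx big1 ?addr0 // => j /negbTE->.
- rewrite (bigD1 i) //= eqxx scale1r big1 ?addr0 // => j /negbTE->.
  by rewrite scale0r.
Qed.

Lemma conv_on_le {k} (A : {set 'I_k}) s y c :
  (forall i, i \in A -> dotp y (s i) <= c) ->
  forall x, conv_on A s x -> dotp y x <= c.
Proof.
move=> sc x [w [w0 wA w1 ->]]; rewrite -subr_le0 dotp_comb_const //.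
apply: sumr_le0 => i _; have [iA|/wA->] := boolP (i \in A).
  by rewrite mulr_ge0_le0 // subr_le0 sc.
by rewrite mul0r.
Qed.

Lemma conv_on_redundant {k} (A : {set 'I_k}) s i :
  conv_on (A :\ i) s (s i) -> conv_on A s `<=` conv_on (A :\ i) s.
Proof.
move=> [v [v0 vA v1 siE]] x [w [w0 wA w1 ->]].
exists (fun j => (if j == i then 0 else w j) + w i * v j); split=> [j|j jA||].
- by rewrite addr_ge0 ?mulr_ge0 //; case: ifP.
- rewrite vA // mulr0 addr0; case: eqVneq => // ji; apply: wA.
  by move: jA; rewrite !inE ji.
- rewrite big_split /= -mulr_sumr v1 mulr1 (bigD1 i) //= eqxx add0r addrC.
  by rewrite -w1 [RHS](bigD1 i) //=; congr (_ + _); apply: eq_bigr => j /negbTE->.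
- rewrite (bigD1 i) //= {1}siE scaler_sumr.
  under [RHS]eq_bigr do rewrite scalerDl -scalerA.
  rewrite [RHS]big_split /= addrC; congr (_ + _).
  rewrite [RHS](bigD1 i) //= eqxx scale0r add0r.
  by apply: eq_bigr => j /negbTE->.
Qed.

(** In an inclusion-minimal generating set no point lies in the hull of the others, so a functional
    separates it from them and exposes it as a vertex. *)
Lemma polytope_vertices (P : set 'rV[R]_n) : is_polytope P ->
  exists k (A : {set 'I_k}) s,
    (forall i, i \in A -> is_vertex P (s i)) /\ P `<=` conv_on A s.
Proof.
case=> k [s PE]; rewrite conv_onT in PE.
pose gen (A : {set 'I_k}) := `[< P `<=` conv_on A s >].
have [A /minsetP[/asboolP PA Amin] _] : {A | minset gen A & A \subset [set: 'I_k]%SET}.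
  by apply: minset_exists; apply/asboolP; rewrite PE.
exists k, A, s; split=> // i iA.
have [/conv_on_redundant red|[y [c [yA yi]]]] := conv_on_separation (A :\ i) s (s i).
  have /setP/(_ i) : A :\ i = A.
    by apply: Amin (subD1set _ _); apply/asboolP; exact: subset_trans PA red.
  by rewrite !inE eqxx iA.
have pos j : j \in A -> j != i -> 0 < dotp y (s j) - dotp y (s i).
  move=> jA ji; have : 0 <= dotp y (s j) + c by apply: yA; rewrite !inE ji.
  by move: yi => /[swap]; lra.
have term_ge0 (w : 'I_k -> R) : (forall i, 0 <= w i) ->
    (forall i, i \notin A -> w i = 0) ->
    forall j, true -> 0 <= w j * (dotp y (s j) - dotp y (s i)).
  move=> w0 wA j _; have [jA|/wA->] := boolP (j \in A); last by rewrite mul0r.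
  apply: mulr_ge0 => //; have [->|ji] := eqVneq j i; first by rewrite subrr.
  exact/ltW/pos.
exists (fun x => dotp y x - dotp y (s i)); split.
- by exists y, (- dotp y (s i)).
- move=> x /PA[w [w0 wA w1 ->]]; rewrite dotp_comb_const //.
  by apply: sumr_ge0; exact: term_ge0.
- apply/seteqP; split=> [_ ->|x [/PA[w [w0 wA w1 xE]] /=]].
    by split; [rewrite PE; apply: conv_on_gen; rewrite inE | rewrite /= subrr].
  (* A vanishing sum of nonnegative terms: by [pos], all weight sits on [i]. *)
  rewrite xE dotp_comb_const // => /psumr_eq0P-/(_ (term_ge0 _ w0 wA)) wh.
  have wi j : j != i -> w j = 0.
    move=> ji; have [jA|/wA//] := boolP (j \in A).
    have /eqP := wh j isT; rewrite mulf_eq0 => /orP[/eqP//|].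
    by rewrite gt_eqF // pos.
  have {}w1 : w i = 1.
    by rewrite -w1 (bigD1 i) //= big1 ?addr0 // => j /wi.
  rewrite (bigD1 i) //= w1 scale1r big1 ?addr0 // => j /wi->.
  by rewrite scale0r.
Qed.

(** Polytopes are bounded: [dotp q] is at most [M] on [P], yet would reach [M + 1] along the ray if
    [q] were nonzero. *)
Lemma polytope_direction (P : set 'rV[R]_n) p q : is_polytope P ->
  (forall t, 0 <= t -> P (p + t *: q)) -> q = 0.
Proof.
case=> k [s PE]; rewrite conv_onT in PE.
move=> Pq; apply/eqP; apply: contraT => q0.
pose M := \sum_i `|dotp q (s i)|.
have PM x : P x -> dotp q x <= M.
  rewrite PE; apply: conv_on_le => i _; rewrite /M (bigD1 i) //=.
  by rewrite (le_trans (ler_norm _)) // lerDl sumr_ge0.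
have Mp : dotp q p <= M by have := PM _ (Pq 0 (lexx 0)); rewrite scale0r addr0.
have t0 : 0 <= (M - dotp q p + 1) / dotp q q.
  by rewrite divr_ge0 ?dotp_ge0 //; lra.
have := PM _ (Pq _ t0); rewrite dotpDr dotpZr divfK ?dotp_eq0 //; lra.
Qed.

Lemma interior_nonzero (P : set 'rV[R]_n) u : interior P 0 -> u != 0 ->
  exists2 x, P x & 0 < dotp u x.
Proof.
move=> P0 u0; have [t t0 Pt] := interior_direction _ _ u P0.
exists (0 + t *: u) => //; rewrite add0r dotpZr mulr_gt0 ?dotp_gt0 //.
Qed.

Lemma hyperplane_vspace (u : 'rV[R]_n) : u != 0 ->
  exists V : {vspace 'rV[R]_n},
    \dim V = n.-1 /\ forall x, (x \in V) = (dotp u x == 0).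
Proof.
move=> u0; pose f : 'Hom('rV[R]_n, 'rV[R]_1) := linfun (mulmxr u^T).
have fE x : (f x == 0) = (dotp u x == 0).
  have fx : f x ord0 ord0 = dotp u x.
    by rewrite lfunE /= mxE dotpC; apply: eq_bigr => i _; rewrite mxE.
  apply/eqP/eqP => [f0|ux]; first by rewrite -fx f0 mxE.
  by apply/rowP => i; rewrite ord1 fx ux mxE.
exists (lker f); split=> [|x]; last by rewrite memv_ker fE.
have := limg_ker_dim f fullv; rewrite capfv dimvf /dim /= mul1n.
suff -> : \dim (limg f) = 1%N by rewrite addn1 => /(congr1 predn).
apply/eqP; rewrite eqn_leq; apply/andP; split.
  by rewrite (leq_trans (dimvS (subvf _))) // dimvf.
rewrite lt0n dimv_eq0; apply: contraNneq u0 => f0.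
by rewrite -dotp_eq0 -fE -memv0 -f0 memv_img ?memvf.
Qed.

End Polytope.

(** * Facets separate outside points from the polytope *)

Section Facets.
Context {R : realType} {n : nat} {P : set 'rV[R]_n}.
Hypotheses (Ppoly : is_polytope P) (Pfull : full_dimensional P).
Hypothesis P0 : interior P 0.

Lemma interior_trivial x : P `<=` [set x] -> n = 0%N.
Proof.
move=> Px; have P00 := interior_subset P0; have x0 := Px _ P00.
case: (posnP n) => // n0.
have u0 : (const_mx 1 : 'rV[R]_n) != 0.
  by apply/eqP => /rowP/(_ (Ordinal n0)); rewrite !mxE; apply/eqP/oner_neq0.
have [y /Px -> ] := interior_nonzero P _ P0 u0.
by rewrite -x0 dotp0r ltxx.
Qed.

(* Among the functionals u bounded by 1 on P and exceeding 1 at x, take one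
   with a maximal set of generators of P on which it equals 1.  These span the
   whole space: otherwise u can be moved orthogonally to them, without decreasing
   dotp u x, until another generator becomes tight. *)
Lemma facet_separation x : ~ P x ->
  exists F u,
    [/\ is_facet P F, F = P `&` [set y | dotp u y = 1], 1 < dotp u x
      & forall v c, (forall y, F y -> dotp v y + c = 0) ->
          forall y, dotp v y + c = c * (1 - dotp u y)].
Proof.
move=> Px; have P00 := interior_subset P0.
have [k [s PE]] := Ppoly; rewrite conv_onT in PE.
have n0 : (0 < n)%N.
  rewrite lt0n; apply/eqP => nz; apply: Px.
  suff -> : x = 0 by [].
  by apply/rowP => i; have := ltn_ord i; rewrite [X in (_ < X)%N]nz.
have Ps i : P (s i) by rewrite PE; apply: conv_on_gen; rewrite inE.
pose feas u := (forall i, dotp u (s i) <= 1) /\ 1 < dotp u x.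
have feasP u : feas u -> forall y, P y -> dotp u y <= 1.
  by case=> us _; rewrite PE; apply: conv_on_le => i _.
have [u1 feas1] : exists u, feas u.
  have [|[y [c [ys yx]]]] := conv_on_separation [set: 'I_k]%SET s x.
    by rewrite -PE.
  (* Since 0 is interior to [P], [c] is positive, and dividing by it normalises the bound to 1. *)
  have yP z : P z -> dotp (- y) z <= c.
    rewrite PE; apply: conv_on_le => i iT; rewrite dotpNl.
    by have := ys i iT; lra.
  have c0 : 0 < c.
    have c_ge0 := yP 0 P00; rewrite dotp0r in c_ge0.
    have [|y0 yz] := interior_nonzero P (- y) P0.
      by apply: contraTneq yx => /eqP; rewrite oppr_eq0 => /eqP->; rewrite dotp0l -leNgt; lra.
    by move=> /lt_le_trans; apply; exact: yP.
  exists (c^-1 *: - y); split=> [i|]; rewrite dotpZl.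
    by rewrite ler_pdivrMl // mulr1 yP.
  by rewrite ltr_pdivlMl // mulr1 dotpNl; move: yx; lra.
pose T u := [set i | dotp u (s i) == 1]%SET.
pose tight (B : {set 'I_k}) := `[< exists2 u, feas u & T u = B >].
have [B /maxsetP[/asboolP[u feasu TB] Bmax] _] :
    {B | maxset tight B & T u1 \subset B}.
  by apply: maxset_exists; apply/asboolP; exists u1.
subst B.
pose X := [seq s i | i in T u].
have XT y : y \in X -> exists2 i, i \in T u & y = s i.
  by case/mapP => i; rewrite mem_enum => iT ->; exists i.
have sX i : i \in T u -> s i \in X by move=> iT; rewrite map_f ?mem_enum.
have Xspan : (fullv <= <<X>>)%VS.
  apply: contraT => /subvPn[v _ vX].
  have [d0 [d0v d0X]] := dual_vector _ _ vX.
  have {d0 v vX d0v d0X} [d [d0 dT dx]] : exists d,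
      [/\ d != 0, forall i, i \in T u -> dotp d (s i) = 0 & 0 <= dotp d x].
    have d00 : d0 != 0.
      by apply: contra_eqN d0v => /eqP->; rewrite dotp0l eq_sym oner_eq0.
    have d0T i : i \in T u -> dotp d0 (s i) = 0.
      by move=> iT; apply/d0X/memv_span/sX.
    have [dx|/ltW dx] := leP 0 (dotp d0 x); first by exists d0.
    exists (- d0); split=> [|i /d0T|]; rewrite ?oppr_eq0 // dotpNl ?oppr_ge0 //.
    by move->; rewrite oppr0.
  have [i0 di0] : exists i, 0 < dotp d (s i).
    apply: contrapT => /forallNP dN.
    have [y] := interior_nonzero P d P0 d0; rewrite PE => yP.
    suff : dotp d y <= 0 by move=> /le_lt_trans h /h; rewrite ltxx.
    by apply: conv_on_le yP => i _; rewrite leNgt; exact/negP/dN.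
  (* Ratio test: [r i] is the distance along [d] at which generator [i] becomes tight, and the
     smallest one keeps all bounds. *)
  pose r i := (1 - dotp u (s i)) / dotp d (s i).
  have [j /= dj rj] := Order.TotalTheory.arg_minP (P := fun i => 0 < dotp d (s i)) r di0.
  have sle i : dotp u (s i) <= 1 by case: feasu.
  have r0 : 0 <= r j by rewrite divr_ge0 ?subr_ge0 // ltW.
  pose u' := u + r j *: d.
  have u'E y : dotp u' y = dotp u y + r j * dotp d y by rewrite dotpDl dotpZl.
  have jT' : j \in T u'.
    by rewrite inE u'E /r divfK ?(gt_eqF dj) // addrC subrK.
  have feasu' : feas u'.
    split=> [i|]; rewrite u'E; last first.
      by rewrite (lt_le_trans (proj2 feasu)) // lerDl mulr_ge0.
    have [di|di] := leP (dotp d (s i)) 0.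
      by rewrite (le_trans _ (sle i)) // gerDl mulr_ge0_le0.
    by have := rj i di; rewrite [X in _ <= X]/r ler_pdivlMr //; lra.
  have TT' : T u' = T u.
    apply: Bmax; first by apply/asboolP; exists u'.
    apply/fintype.subsetP => i iT; rewrite inE u'E dT // mulr0 addr0.
    by move: iT; rewrite inE.
  (* The newly tight [j] would already lie in [T u], where [d] vanishes, although [d] is positive at
     [s j]. *)
  by move: dj; rewrite dT ?ltxx // -TT'.
have coordX y : y = \sum_i coord (in_tuple X) i y *: X`_i.
  by apply: (@coord_span _ _ _ (in_tuple X)); apply: subvP Xspan _ (memvf y).
have uX (i : 'I_(size X)) : P X`_i /\ dotp u X`_i = 1.
  have [j jT ->] := XT _ (mem_nth 0 (ltn_ord i)).
  by split=> //; apply/eqP; move: jT; rewrite inE.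
pose F := P `&` [set y | dotp u y = 1].
have uP := feasP _ feasu; have ux := proj2 feasu.
exists F, u; split=> //; last first.
  move=> v c vF y.
  (* On tight generators [u] is 1 and [v] is [- c], so [v + c *: u] vanishes on a spanning set. *)
  suff : dotp (v + c *: u) y = 0 by rewrite dotpDl dotpZl; lra.
  rewrite (coordX y) dotp_sumr big1 // => i _; have [Pi ui] := uX i.
  by rewrite dotpZr dotpDl dotpZl ui mulr1 vF ?mulr0.
have u0 : u != 0.
  by apply: contraTneq ux => ->; rewrite dotp0l -leNgt ler01.
split.
  exists (fun y => - dotp u y + 1); split=> [|y /uP|].
  - by exists (- u), 1 => y; rewrite dotpNl.
  - lra.
  - by apply/seteqP; split=> y [Py /=] h; split=> //=; lra.
exists n.-1; rewrite prednK //; split=> //.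
have [V [dV VE]] := hyperplane_vspace u u0.
pose x0 := (dotp u u)^-1 *: u.
have ux0 : dotp u x0 = 1 by rewrite dotpZr mulVf // dotp_eq0.
exists x0, V; split=> //; apply/seteqP; split=> y /=.
  move=> [l [q [w [qF w1 ->]]]]; rewrite VE dotpBr ux0 dotp_comb_const //.
  by apply/eqP; rewrite big1 // => i _; have [_ ->] := qF i; rewrite subrr mulr0.
rewrite VE dotpBr ux0 subr_eq0 => /eqP uy.
(* Linear coordinates of [y] are affine ones: [u] is 1 at [y] and at every [X_i], so they sum to
   1. *)
exists (size X), (fun i => X`_i), (fun i => coord (in_tuple X) i y).
split=> [i||]; [by have [] := uX i| |exact: coordX].
rewrite -uy [in RHS](coordX y) dotp_sumr; apply: eq_bigr => i _.
by rewrite dotpZr (proj2 (uX i)) mulr1.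
Qed.

End Facets.

(** A facet requires [P] to have dimension at least 1; this supplies [0 < n] for
    [lift_dual_vector]. *)
Lemma facet_ambient_gt0 {R : realType} {n : nat} (P F : set 'rV[R]_n) :
  is_facet P F -> (0 < n)%N.
Proof.
case=> _ [d [[x0 [V [dV _]]] _]]; apply: (@leq_trans d.+1) => //.
by have := dimvS (subvf V); rewrite dimvf /dim /= mul1n dV.
Qed.

(** * From lifts to factorizations and back *)

Section Yannakakis.
Context {R : realType} {m n : nat} {K : set 'rV[R]_m} {P : set 'rV[R]_n}.
Hypotheses (Kcone : is_convex_cone K).
Hypotheses (Ppoly : is_polytope P) (Pfull : full_dimensional P).
Hypothesis P0 : interior P 0.

Lemma cone0 : K 0.
Proof. by case: (Kcone) => -[x Kx] _ _; rewrite -(scale0r x); apply: coneZ. Qed.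

Lemma cone_sum k (w : 'I_k -> R) z :
  (forall i, K (w i *: z i)) -> K (\sum_i w i *: z i).
Proof.
move=> Kz; apply: (big_ind K) => // [|x y]; first exact: cone0.
exact: coneD.
Qed.

(* As P is bounded and not a point, t *: e + d in K with d in the direction V
   of L forces 0 <= t; hence the homogenisation of h \o phi is nonnegative on
   the part of K lying in the span of L. *)
Lemma lift_dual_vector L (phi : {linear 'rV[R]_m -> 'rV[R]_n}) h :
  (0 < n)%N -> is_lift K P L phi -> L `&` interior K !=set0 ->
  is_affine_fun h -> (forall x, P x -> 0 <= h x) ->
  exists2 b, dual_cone K b &
    forall x, K x -> L x -> dotp x b = h (phi x).
Proof.
move=> n0 [[x0 [V LE]] PE] [e [Le Ke]] [u [c hE]] hP.
have {x0 LE Le} LE x : L x <-> x - e \in V.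
  move: Le; rewrite LE /= => eV; split=> xV.
    by have := memvB xV eV; rewrite opprB addrA subrK.
  by have := memvD xV eV; rewrite addrA subrK.
have Le : L e by apply/LE; rewrite subrr mem0v.
have Kee := interior_subset Ke.
have LeD v : v \in V -> L (e + v) by move=> vV; apply/LE; rewrite addrC addKr.
have rec0 d : d \in V -> K d -> phi d = 0.
  move=> dV Kd; apply: (polytope_direction P (phi e)) => // t t0.
  rewrite -linearZ -linearD PE; exists (e + t *: d) => //; split.
    by apply: coneD => //; exact: coneZ.
  by apply/LeD/memvZ.
have pos t d : d \in V -> K (t *: e + d) -> 0 <= t.
  move=> dV Kd; rewrite leNgt; apply/negP => t0.
  (* Adding [- t] times [e + r *: v] cancels [t *: e] and leaves a recession direction, killed by
     [phi]. Hence [phi] would vanish on [V] and [P] would be a point. *)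
  have shift r v : v \in V -> K (e + r *: v) -> phi (d + (- t * r) *: v) = 0.
    move=> vV Kv; apply: rec0; first by rewrite memvD ?memvZ.
    have t1 : 0 <= - t by rewrite oppr_ge0 ltW.
    have := coneD Kcone _ _ Kd (coneZ Kcone _ _ t1 Kv).
    by rewrite scalerDr scaleNr addrACA subrr add0r scalerA.
  have phid : phi d = 0.
    by have := shift 0 0 (mem0v _); rewrite !scaler0 !addr0; apply.
  suff : n = 0%N by move=> nE; move: n0; rewrite nE.
  apply: (interior_trivial P0 (phi e)) => y; rewrite PE => -[x [_ /LE xV] <-].
  have [r r0 Kr] := interior_direction _ _ (x - e) Ke.
  have := shift r _ xV Kr; rewrite linearD phid add0r linearZ /= => /eqP.
  rewrite scaler_eq0 mulf_eq0 oppr_eq0 (lt_eqF t0) (gt_eqF r0) /=.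
  by rewrite linearB subr_eq0 => /eqP.
have eV : e \notin V.
  apply/negP => /(pos (- 1)); rewrite scaleN1r addNr => /(_ cone0).
  by rewrite oppr_ge0 ler10.
have [eta [etae etaV]] := dual_vector _ _ eV.
have [u' u'E] := dotp_adjoint phi u.
(* The homogenisation of [h \o phi]: [eta] is 1 at [e] and 0 on [V], so it carries the constant
   term. *)
pose U := u' + c *: eta.
have UV d : d \in V -> dotp U d = dotp u (phi d).
  by move=> dV; rewrite dotpDl dotpZl etaV // mulr0 addr0 u'E.
have Ue : dotp U e = h (phi e) by rewrite dotpDl dotpZl etae mulr1 u'E hE.
have UL x : L x -> dotp U x = h (phi x).
  move=> /LE xV; rewrite -(subrK e x); move: (x - e) xV => d dV.
  by rewrite dotpDr UV // Ue linearD !hE dotpDr addrA.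
have [||b Kb bE] := dual_cone_extension Kcone (<[e]> + V)%VS e U Ke.
- exact: (subvP (addvSl _ _) _ (memv_line e)).
- move=> x Kx /memv_addP[_ /vlineP[t ->] [d dV xE]].
  rewrite xE; rewrite {}xE in Kx.
  have := pos _ _ dV Kx; rewrite le_eqVlt => /predU1P[t0|t0].
    move: Kx; rewrite -t0 scale0r add0r => Kd.
    by rewrite UV // rec0 // dotp0r.
  have dE : t *: e + d = t *: (e + t^-1 *: d).
    by rewrite scalerDr scalerA divff ?gt_eqF // scale1r.
  have Ld : L (e + t^-1 *: d) by apply/LeD/memvZ.
  have Kd : K (e + t^-1 *: d).
    have := coneZ Kcone t^-1 _ _ Kx; rewrite dE scalerA mulVf ?gt_eqF // scale1r.
    by apply; rewrite invr_ge0 ltW.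
  rewrite dE dotpZr mulr_ge0 ?(ltW t0) // UL // hP // PE.
  by exists (e + t^-1 *: d).
exists b => // x Kx Lx; rewrite bE ?UL //.
rewrite -[x](subrK e) addrC memv_add ?memv_line //.
exact/LE.
Qed.

Lemma proper_lift_factorization v f (M : 'M[R]_(v, f)) :
  has_proper_lift K P -> is_slack_matrix P M -> has_factorization K M.
Proof.
move=> [L [phi [lft Lint]]] [p [F [h [[_ pE] [_ FE] hA hF ->]]]].
have [_ PE] := lft.
have /choice[a aP] i : exists x, (K `&` L) x /\ phi x = p i.
  have : is_vertex P (p i) by rewrite -[is_vertex P _]/([set x | is_vertex P x] _) -pE; exists i.
  case=> g [_ _ gE]; have : [set p i] (p i) by [].
  by rewrite gE PE => -[[x Kx <-] _]; exists x.
have /choice[b bP] j :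
    exists y, dual_cone K y /\ forall x, K x -> L x -> dotp x y = h j (phi x).
  have fj : is_facet P (F j).
    by rewrite -[is_facet P _]/([set G | is_facet P G] _) -FE; exists j.
  have [y Ky yE] := lift_dual_vector L phi (h j) (facet_ambient_gt0 _ _ fj) lft
    Lint (hA j) (proj1 (hF j)).
  by exists y.
exists a, b; split=> [i|j|i j].
- by have [[]] := aP i.
- by have [] := bP j.
- have [[Ka La] phia] := aP i; rewrite mxE -phia.
  exact: (proj2 (bP j)).
Qed.

(** For [x] outside [P], [facet_separation] yields a facet whose defining function must be
    [c * (1 - dotp u y)]. Here [c > 0], as otherwise 0 would lie on the facet; so that function is
    negative at [x]. *)
Lemma facet_inequalities {f} {F : 'I_f -> set 'rV[R]_n} {h} :
  range F = [set G | is_facet P G] -> (forall j, is_affine_fun (h j)) ->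
  (forall j, (forall x, P x -> 0 <= h j x) /\
     F j = [set x | P x /\ h j x = 0]) ->
  forall x, P x <-> forall j, 0 <= h j x.
Proof.
move=> FE hA hF x; split=> [Px j|hx]; first by apply: (proj1 (hF j)).
apply: contrapT => Px.
have [G [u [Gf GE ux Gu]]] := facet_separation Ppoly Pfull P0 x Px.
have [j _ FjG] : range F G by rewrite FE.
have [w [c hE]] := hA j; have [hP FjE] := hF j.
have hu y : h j y = c * (1 - dotp u y).
  rewrite hE; apply: Gu => {}y; rewrite -FjG FjE => -[_].
  by rewrite hE.
have c0 : 0 <= c.
  by have := hP 0 (interior_subset P0); rewrite hu dotp0r subr0 mulr1.
have {}c0 : c = 0.
  apply/eqP; rewrite eq_le c0 andbT leNgt; apply/negP => cp.
  by have := hx j; rewrite hu pmulr_rge0 // leNgt subr_lt0 ux.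
have : F j 0.
  by rewrite FjE; split; [exact: interior_subset P0 | rewrite hu c0 mul0r].
by rewrite FjG GE => -[_ /=]; rewrite dotp0r => /esym/eqP; rewrite oner_eq0.
Qed.

Lemma factorization_lift v f (M : 'M[R]_(v, f)) :
  is_slack_matrix P M -> has_factorization K M -> has_lift K P.
Proof.
move=> [p [F [h [[_ pE] [_ FE] hA hF ->]]]] [a [b [Ka Kb abE]]].
have P00 := interior_subset P0.
(* For [n = 0] the zero map on the whole space works; the proof that 0 is not in [L] needs
   [0 < n]. *)
case: (posnP n) => [nz|n0].
  have all0 (x : 'rV[R]_n) : x = 0.
    by apply/rowP => i; have := ltn_ord i; rewrite [X in (_ < X)%N]nz.
  exists setT, (0 : 'Hom('rV[R]_m, 'rV[R]_n)); split.
    by exists 0, fullv; apply/seteqP; split=> x // _ /=; exact: memvf.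
  apply/seteqP; split=> y; last by rewrite (all0 y).
  by exists 0; [split=> //; exact: cone0 | rewrite [LHS]all0 [RHS]all0].
have hP := facet_inequalities FE hA hF.
have /choice[u /choice[c hE]] := hA.
pose rel z x := forall j, h j x = dotp z (b j).
have relap i : rel (a i) (p i) by move=> j; rewrite abE mxE.
have [k [A [s [sA PA]]]] := polytope_vertices P Ppoly.
have sp i : i \in A -> exists l, s i = p l.
  move=> /sA si; have : range p (s i) by rewrite pE.
  by case=> l _ <-; exists l.
have [i0 _] : exists i0 : 'I_v, True.
  have [w [_ wA w1 _]] := PA _ P00.
  have [i iA] : exists i, i \in A.
    apply: contrapT => /forallNP AN; move: w1; rewrite big1.
      by move/esym/eqP; rewrite oner_eq0.
    by move=> i _; apply: wA; apply/negP/AN.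
  by have [l _] := sp i iA; exists l.
pose fam q (y : 'I_f -> 'rV[R]_q) : 'Hom('rV[R]_q, 'rV[R]_f) :=
  linfun (mulmxr (\matrix_(i, j) y j ord0 i)).
have famE q (y : 'I_f -> 'rV[R]_q) z j : fam q y z ord0 j = dotp z (y j).
  by rewrite lfunE /= mxE; apply: eq_bigr => i _; rewrite mxE.
pose At := fam m b; pose Bt := fam n u.
(* Along a kernel direction of [Bt] no [h j] changes, so it is a recession direction of [P]. *)
have kerB : lker Bt == 0%VS.
  rewrite -subv0; apply/subvP => q; rewrite memv_ker => /eqP Bq.
  rewrite memv0; apply/eqP; apply: (polytope_direction P 0) => // t t0.
  apply/hP => j; rewrite hE dotpDr dotpZr [dotp (u j) q]dotpC -famE.
  rewrite -/Bt Bq mxE mulr0 addr0 -hE.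
  exact: (proj1 (hF j)).
pose V := (At @^-1: limg Bt)%VS.
have rel_diff z x z' x' : rel z x -> rel z' x' -> At (z - z') = Bt (x - x').
  move=> zx zx'; apply/rowP => j; rewrite !famE dotpBl -zx -zx' !hE.
  by rewrite dotpBl !(dotpC _ (u j)); lra.
pose L := [set z | z - a i0 \in V].
have LP z : L z <-> exists x, rel z x.
  rewrite /L /= /V -memv_preim; split=> [/memv_imgP[q _ zq]|[x zx]].
    exists (p i0 + q) => j; rewrite hE dotpDr -addrA [_ + c j]addrC addrA -hE.
    have /rowP/(_ j) := zq; rewrite !famE dotpBl abE mxE (dotpC q) => <-.
    by rewrite addrC subrK.
  by rewrite (rel_diff _ _ _ _ zx (relap i0)) memv_img ?memvf.
(* Otherwise all [h j] vanish at a common point; every direction from it into [P] is then a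
   recession direction, so [P] is that point. *)
have a0V : a i0 \notin V.
  apply/negP; rewrite -memv_preim => /memv_imgP[q _ aq].
  have hx j : h j (p i0 - q) = 0.
    rewrite hE dotpBr addrAC -hE (relap i0) -famE -/At aq famE dotpC.
    exact: subrr.
  suff nz : n = 0%N by move: n0; rewrite nz.
  apply: (interior_trivial P0 (p i0 - q)) => y Py.
  apply/eqP; rewrite -subr_eq0; apply/eqP.
  apply: (polytope_direction P (p i0 - q)) => // t t0; apply/hP => j.
  rewrite hE dotpDr addrAC -hE hx add0r dotpZr mulr_ge0 // dotpBr.
  by have := proj1 (hF j) _ Py; have := hx j; rewrite !hE; lra.
have [eta [etaa etaV]] := dual_vector _ _ a0V.
pose rk1 q (r : 'rV[R]_q) : 'Hom('rV[R]_m, 'rV[R]_q) :=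
  linfun (mulmxr (eta^T *m r)).
have rk1E q (r : 'rV[R]_q) z : rk1 q r z = dotp eta z *: r.
  rewrite lfunE /= mulmxA -mul_scalar_mx; congr (_ *m _).
  apply/rowP => i; rewrite !mxE ord1 eqxx mulr1n dotpC.
  by apply: eq_bigr => l _; rewrite mxE.
(* On [L], [dotp eta z] is 1, so this linear map agrees with the affine map sending [z] to
   [p i0 + Bt^-1 (At (z - a i0))]. *)
pose phi := (Bt^-1 \o (At \o (\1 - rk1 m (a i0))) + rk1 n (p i0))%VF.
have phiE z x : rel z x -> phi z = x.
  move=> zx; have zV : z - a i0 \in V by apply/LP; exists x.
  have etaz : dotp eta z = 1 by rewrite -(subrK (a i0) z) dotpDr etaV // add0r.
  rewrite add_lfunE !comp_lfunE add_lfunE opp_lfunE id_lfunE !rk1E etaz !scale1r.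
  by rewrite (rel_diff _ _ _ _ zx (relap i0)) lker0_lfunK // subrK.
exists L, phi; split; first by exists (a i0), V.
apply/seteqP; split=> [y Py|_ [z [Kz /LP[x zx]] <-]]; last first.
  by rewrite /= (phiE _ _ zx); apply/hP => j; rewrite zx; exact: (Kb j).
have /choice[z zP] i : exists z, i \in A -> K z /\ rel z (s i).
  have [/sp[l ->]|_] := boolP (i \in A); last by exists 0.
  by exists (a l).
have [w [w0 wA w1 yE]] := PA _ Py.
(* [rel] is preserved by affine combinations, so the weights expressing [y] by vertices also lift
   it. *)
have zy : rel (\sum_i w i *: z i) y.
  move=> j; rewrite hE yE dotp_comb_const // dotpC dotp_sumr.
  apply: eq_bigr => i _; rewrite dotpZr.
  have [iA|/wA->] := boolP (i \in A); last by rewrite !mul0r.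
  by rewrite -hE (proj2 (zP i iA)) dotpC.
exists (\sum_i w i *: z i); last exact: phiE.
split; last by apply/LP; exists y.
apply: cone_sum => i; have [iA|/wA->] := boolP (i \in A).
  by apply: coneZ => //; exact: (proj1 (zP i iA)).
by rewrite scale0r; exact: cone0.
Qed.

End Yannakakis.

Theorem theorem3p3 (R : realType) (m n : nat)
  (K : set 'rV[R]_m) (P : set 'rV[R]_n)
  (Kcone : is_convex_cone K) (Kclosed : closed K) (Kfull : full_dimensional K)
  (Ppoly : is_polytope P) (Pfull : full_dimensional P)
  (P0 : interior P (0 : 'rV[R]_n)) :
  (has_proper_lift K P ->
     forall (v f : nat) (M : 'M[R]_(v, f)),
       is_slack_matrix P M -> has_factorization K M) /\
  ((exists (v f : nat) (M : 'M[R]_(v, f)),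
      is_slack_matrix P M /\ has_factorization K M) ->
     has_lift K P).
Proof.
split=> [lift v f M slack|[v [f [M [slack fact]]]]].
  exact: proper_lift_factorization slack.
exact: factorization_lift slack fact.
Qed.
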